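(* Let $m\in\mathbb{N}^{*}$, let $(X,d)$ be a complete metric space, and let $\mathcal{F}=((X,d),(f_i)_{i\in I})$ be a generalized possibly infinite iterated function system of order $m$. Suppose that at least one of the following conditions is satisfied: (i) there exists a comparison function $\varphi$ such that all the functions $f_i$, $i\in I$, are $\varphi$-contractions; (ii) the family of functions $(f_i)_{i\in I}$ is uniformly Meir-Keeler; (iii) $I$ is finite and all the functions $f_i$, $i\in I$, are Meir-Keeler. Let $\pi_0\in\mathcal{C}$ be the unique element of $\mathcal{C}$ such that $H_{\mathcal{F}}(\pi_0,\dots,\pi_0)=\pi_0$ and $\lim_{n\to\infty}H_{\mathcal{F}}^{[n]}(f,\dots,f)=\pi_0$ for every $f\in\mathcal{C}$. Then $\pi_0$ is the canonical projection associated to $\mathcal{F}$, i.e. $\pi_0=\pi$, where $\pi:\Omega\to X$ is the function determined by $$\{\pi(\alpha)\}=\bigcap_{k\ge1}\overline{f_{\alpha^1\alpha^2\dots\alpha^k}(A_{\mathcal{F}},\dots,A_{\mathcal{F}})}\qquad\text{for every }\alpha=\alpha^1\alpha^2\dots\in\Omega,$$ and $A_{\mathcal{F}}$ is the attractor of $\mathcal{F}$.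
   Context: $\mathbb{N}^{*}=\{1,2,\dots\}$. The sets $X$ and $I$ are nonempty. For a metric space $(Y,\rho)$ and $m\in\mathbb{N}^*$, $Y^m$ carries the maximum metric $\rho_{\max}((x_1,\dots,x_m),(y_1,\dots,y_m))=\max_j \rho(x_j,y_j)$; for $(X,d)$ it is written $d_{\max}$. A generalized possibly infinite iterated function system of order $m$ is a pair $\mathcal{F}=((X,d),(f_i)_{i\in I})$, where $(X,d)$ is a metric space, each $f_i:X^m\to X$ is continuous, and the family $(f_i)_{i\in I}$ is bounded, i.e. $\bigcup_{i\in I}f_i(B)$ is bounded for every bounded $B\subseteq X^m$. Attractor: let $\mathcal{B}(X)$ be the set of nonempty closed bounded subsets of $X$ and $\mathcal{K}(X)$ the set of nonempty compact subsets of $X$. The fractal operator $\mathcal{F}_{\mathcal{F}}:\mathcal{B}(X)^m\to\mathcal{B}(X)$ is $\mathcal{F}_{\mathcal{F}}(B_1,\dots,B_m)=\overline{\bigcup_{i\in I}f_i(B_1\times\dots\times B_m)}$. The attractor $A_{\mathcal{F}}$ is the unique $A\in\mathcal{B}(X)$ with $\mathcal{F}_{\mathcal{F}}(A,\dots,A)=A$; if $I$ is finite, the convention is that $\mathcal{F}_{\mathcal{F}}$ is regarded as a map $\mathcal{K}(X)^m\to\mathcal{K}(X)$ and $A_{\mathcal{F}}$ is the unique $A\in\mathcal{K}(X)$ with $\mathcal{F}_{\mathcal{F}}(A,\dots,A)=A$. Code space: $\Omega_1=I$, $\Omega_{k+1}=\Omega_k\times\dots\times\Omega_k$ ($m$ times),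 ${}_k\Omega=\Omega_1\times\dots\times\Omega_k$, and $\Omega=\Omega_1\times\Omega_2\times\cdots$. Elements of $\Omega$ are written $\alpha=\alpha^1\alpha^2\dots\alpha^k\dots$ with $\alpha^k\in\Omega_k$ (similarly for ${}_k\Omega$, with finitely many entries); for $k\ge2$ write $\alpha^k=\alpha^k_1\alpha^k_2\dots\alpha^k_m$ with $\alpha^k_i\in\Omega_{k-1}$. For $i\in\{1,\dots,m\}$ put $\alpha(i)=\alpha^2_i\alpha^3_i\alpha^4_i\dots\in\Omega$ if $\alpha\in\Omega$, and $\alpha(i)=\alpha^2_i\alpha^3_i\dots\alpha^k_i\in{}_{k-1}\Omega$ if $\alpha\in{}_k\Omega$, $k\ge2$. $\Omega$ is endowed with the metric $d(\alpha,\beta)=\sum_{k\ge1}c^k\,\delta(\alpha^k,\beta^k)$, where $c\in(0,1)$ is fixed and $\delta(\alpha^k,\beta^k)$ is $1$ if $\alpha^k\neq\beta^k$ and $0$ otherwise. Iterated maps: let $X_1=X^m$ and $X_{k+1}=X_k\times\dots\times X_k$ ($m$ times), identified with $X^{m^{k+1}}$. For $\alpha\in{}_k\Omega$ the map $f_\alpha:X_k\to X$ is defined inductively: for $k=1$ these are the maps $f_i$, $i\in I$; for $\alpha=\alpha^1\dots\alpha^{k+1}\in{}_{k+1}\Omega$, $f_\alpha(x_1,\dots,x_m)=f_{\alpha^1}(f_{\alpha(1)}(x_1),\dots,f_{\alpha(m)}(x_m))$ for $(x_1,\dots,x_m)\in X_{k+1}$. For $\alpha\in{}_k\Omega$, $f_\alpha(A,\dots,A)$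 denotes the image under $f_\alpha$ of $A^{m^k}\subseteq X^{m^k}=X_k$. $\mathcal{C}$ is the set of continuous bounded functions $f:\Omega\to X$ with the metric $d_u(f,g)=\sup_{\alpha\in\Omega}d(f(\alpha),g(\alpha))$. The operator $H_{\mathcal{F}}:\mathcal{C}^m\to\mathcal{C}$ is $H_{\mathcal{F}}(g_1,\dots,g_m)(\alpha)=f_{\alpha^1}(g_1(\alpha(1)),\dots,g_m(\alpha(m)))$ for $\alpha=\alpha^1\alpha^2\dots\in\Omega$. For a set $Y$ and $f:Y^m\to Y$, the functions $f^{[k]}:Y^{m^k}\to Y$ are defined by $f^{[1]}=f$ and $f^{[k+1]}(x_1,\dots,x_m)=f(f^{[k]}(x_1),\dots,f^{[k]}(x_m))$ for $(x_1,\dots,x_m)\in Y^{m^k}\times\dots\times Y^{m^k}=Y^{m^{k+1}}$. A comparison function is a map $\varphi:[0,\infty)\to[0,\infty)$ that is nondecreasing, right-continuous, and satisfies $\varphi(t)<t$ for all $t>0$. A map $f:X^m\to X$ is a $\varphi$-contraction if $d(f(x),f(y))\le\varphi(d_{\max}(x,y))$ for all $x,y\in X^m$. It is Meir-Keeler if for every $\varepsilon>0$ there is $\delta_\varepsilon>0$ such that $d(f(x),f(y))<\varepsilon$ for all $x,y\in X^m$ with $d_{\max}(x,y)<\varepsilon+\delta_\varepsilon$. A family $(f_i)_{i\in I}$ of maps $X^m\to X$ is uniformly Meir-Keeler if for every $\varepsilon>0$ there are $\delta_\varepsilon,\lambda_\varepsilon>0$ such that $d(f_i(x),f_i(y))<\varepsilon-\lambda_\varepsilon$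 for all $i\in I$ and all $x,y\in X^m$ with $d_{\max}(x,y)<\varepsilon+\delta_\varepsilon$. Under the hypotheses of the claim, $\pi_0$ and $A_{\mathcal{F}}$ exist, and the intersection defining $\pi(\alpha)$ consists of exactly one point for each $\alpha\in\Omega$. *)

(* Defs.v *)
From HB Require Import structures.
From mathcomp Require Import all_boot all_order all_algebra.
From mathcomp Require Import all_classical all_reals all_analysis.

Set Implicit Arguments.
Unset Strict Implicit.
Unset Printing Implicit Defensive.

Import Order.TTheory GRing.Theory Num.Theory.
Import numFieldNormedType.Exports.

Local Open Scope classical_set_scope.
Local Open Scope ring_scope.

(* [Complete] includes a distinguished point, so these spaces are nonempty. *)
#[short(type="completeMetricType")]
HB.structure Definition CompleteMetric (K : numDomainType) :=
  {T of Complete T & Metric K T}.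

Section bounded.
Context {R : realType} {X : metricType R}.

Definition metric_bounded (A : set X) : Prop :=
  exists M : R, forall x y, A x -> A y -> mdist x y <= M.

End bounded.

(* Y^m, an alias of 'I_m -> Y so that it can carry the maximum metric. *)
Definition power (m : nat) (Y : Type) : Type := 'I_m -> Y.

HB.instance Definition _ m Y := gen_eqMixin (power m Y).
HB.instance Definition _ m Y := gen_choiceMixin (power m Y).

Section power_metric.
Context {R : realType} (m : nat) (Y : metricType R).

Definition dmax (x y : power m Y) : R :=
  \big[Num.max/0]_(j < m) mdist (x j) (y j).

Lemma dmax_ge0 x y : 0 <= dmax x y.
Proof. exact: bigmax_ge_id. Qed.

Lemma dmax_ge x y j : mdist (x j) (y j) <= dmax x y.
Proof. exact: (le_bigmax_cond _ (fun j => mdist (x j) (y j))). Qed.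

Lemma dmax_le x y e : 0 <= e -> (forall j, mdist (x j) (y j) <= e) ->
  dmax x y <= e.
Proof. by move=> e0 h; apply/bigmax_leP; split. Qed.

Lemma dmaxxx x : dmax x x = 0.
Proof.
apply/eqP; rewrite eq_le dmax_ge0 andbT; apply: dmax_le => // j.
by rewrite mdistxx.
Qed.

Lemma dmax_positivity x y : dmax x y = 0 -> x = y.
Proof.
move=> xy0; apply/funext => j; apply: (@mdist_positivity R).
by apply/eqP; rewrite eq_le mdist_ge0 andbT -xy0 dmax_ge.
Qed.

Lemma dmax_sym x y : dmax x y = dmax y x.
Proof. by apply: eq_bigr => j _; rewrite metric_sym. Qed.

Lemma dmax_triangle y x z : dmax x z <= dmax x y + dmax y z.
Proof.
apply: dmax_le => [|j]; first by rewrite addr_ge0 ?dmax_ge0.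
by rewrite (le_trans (metric_triangle _ (y j) _))// lerD ?dmax_ge.
Qed.

HB.instance Definition _ := @isMetric.Build R (power m Y)
  dmax dmaxxx dmax_positivity dmax_sym dmax_triangle.

End power_metric.

(* The iterated powers Y, Y^m, (Y^m)^m, ...: the code sets are
   Omega_(k+1) = tower m I k, and X_k = tower m X k is X^(m^k). *)
Fixpoint tower (m : nat) (Y : Type) (k : nat) : Type :=
  if k is k'.+1 then power m (tower m Y k') else Y.

Fixpoint tower_set m Y (A : set Y) k : set (tower m Y k) :=
  match k with
  | 0 => A
  | k'.+1 => [set x : power m (tower m Y k') | forall j, tower_set A (x j)]
  end.
Arguments tower_set {m Y} A k.

Fixpoint tower_diag m Y (y : Y) k : tower m Y k :=
  match k with
  | 0 => y
  | k'.+1 => fun=> tower_diag m y k'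
  end.

(* f^[k]; starting from f^[0] = id makes f^[1] = f by eta-conversion. *)
Fixpoint iter_power m Y (f : power m Y -> Y) k : tower m Y k -> Y :=
  match k with
  | 0 => id
  | k'.+1 => fun x => f (fun j => iter_power f (x j))
  end.
Arguments iter_power {m Y} f k.

Section code_space.
Context {R : realType} (m : nat) (I : Type) (c : R) (c01 : 0 < c < 1).

(* Omega, with entries indexed from 0: [a k] is alpha^(k+1).  The constant c
   only selects the metric. *)
Definition code_space of 0 < c < 1 : Type := forall k, tower m I k.

Local Notation Omega := (code_space c01).

HB.instance Definition _ := gen_eqMixin Omega.
HB.instance Definition _ := gen_choiceMixin Omega.

Definition code_dist_term (a b : Omega) (k : nat) : R :=
  c ^+ k.+1 * (~~ `[< a k = b k >])%:R.

Definition code_dist (a b : Omega) : R := limn (series (code_dist_term a b)).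

Lemma code_dist_term_ge0 a b k : 0 <= code_dist_term a b k.
Proof.
by case/andP: c01 => c0 _; rewrite mulr_ge0// exprn_ge0// ltW.
Qed.

Lemma code_dist_cvg a b : cvgn (series (code_dist_term a b)).
Proof.
case/andP: c01 => c0 c1.
apply: (@series_le_cvg _ _ (geometric c c)).
- exact: code_dist_term_ge0.
- by move=> k; rewrite /= mulr_ge0 ?exprn_ge0// ltW.
- move=> k; rewrite /code_dist_term /= -exprS ler_piMr ?exprn_ge0 ?(ltW c0)//.
  by case: (~~ _).
- by apply: is_cvg_geometric_series; rewrite ger0_norm ?ltW.
Qed.

Lemma code_dist_term_le a b k : code_dist_term a b k <= code_dist a b.
Proof.
apply: (@le_trans _ _ (series (code_dist_term a b) k.+1)).
  rewrite /series /= big_nat_recr//= lerDr sumr_ge0// => i _.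
  exact: code_dist_term_ge0.
apply: nondecreasing_cvgn_le; last exact: code_dist_cvg.
apply/nondecreasing_seqP => n.
by rewrite /series/= big_nat_recr//= lerDl code_dist_term_ge0.
Qed.

Lemma code_distxx a : code_dist a a = 0.
Proof.
rewrite /code_dist (_ : series _ = fun=> 0) ?lim_cst//.
apply/funext => n; rewrite /series/= big1// => k _.
by rewrite /code_dist_term asboolT ?mulr0.
Qed.

Lemma code_dist_positivity a b : code_dist a b = 0 -> a = b.
Proof.
case/andP: c01 => c0 _ ab0.
apply: functional_extensionality_dep => k; apply: contrapT => abk.
have := code_dist_term_le a b k.
by rewrite ab0 /code_dist_term asboolF// mulr1 leNgt exprn_gt0.
Qed.

Lemma code_dist_sym a b : code_dist a b = code_dist b a.
Proof.
congr (limn (series _)); apply/funext => k.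
by rewrite /code_dist_term; congr (_ * (~~ _)%:R); apply/asbool_equiv_eq; split.
Qed.

Lemma code_dist_triangle b a d :
  code_dist a d <= code_dist a b + code_dist b d.
Proof.
rewrite /code_dist -lim_seriesD; [|exact: code_dist_cvg..].
apply: lim_series_le; [exact: code_dist_cvg| |].
  by apply: is_cvg_seriesD; exact: code_dist_cvg.
case/andP: c01 => c0 _ k; rewrite /= /code_dist_term /GRing.add/= -mulrDr.
rewrite ler_wpM2l ?exprn_ge0 ?(ltW c0)//.
case: (asboolP (a k = b k)) => [->|_]; first by rewrite add0r.
by rewrite (le_trans (_ : _ <= 1))// ?lerDl//; case: (~~ _).
Qed.

HB.instance Definition _ := @isMetric.Build R Omega code_dist
  code_distxx code_dist_positivity code_dist_sym code_dist_triangle.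

(* alpha(j) *)
Definition shift_code (a : Omega) (j : 'I_m) : Omega := fun k => a k.+1 j.

End code_space.

(* The set {}_kOmega of finite codes alpha^1 ... alpha^k *)
Definition fin_code (m : nat) (I : Type) (k : nat) : Type :=
  forall i : 'I_k, tower m I i.

Definition shift_fin_code m I k (a : fin_code m I k.+1) (j : 'I_m) :
  fin_code m I k := fun i => a (lift ord0 i) j.

Definition code_prefix (R : realType) m I (c : R) (c01 : 0 < c < 1)
  (a : code_space m I c01) k : fin_code m I k := fun i => a i.
Arguments code_prefix {R m I c c01} a k.

(* Generalized possibly infinite iterated function systems of order m, for the
   maximum metric on X^m *)
Record gifs (R : realType) (m : nat) (X : metricType R) (I : Type) := Gifs {
  gifs_fun :> I -> power m X -> X;
  gifs_continuous : forall i, continuous (gifs_fun i);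
  gifs_bounded : forall B : set (power m X), metric_bounded B ->
    metric_bounded (\bigcup_i (gifs_fun i @` B)) }.

Section attractor.
Context {R : realType} {m : nat} {X : metricType R} {I : Type}.
Variable F : gifs m X I.

Definition fractal_operator (B : power m (set X)) : set X :=
  closure (\bigcup_i (F i @` [set x : power m X | forall j, B j (x j)])).

Definition BX : set (set X) :=
  [set B | [/\ B !=set0, closed B & metric_bounded B]].

Definition KX : set (set X) := [set B | B !=set0 /\ compact B].

Definition unique_fixed_set (S : set (set X)) (A : set X) : Prop :=
  unique (fun B => S B /\ fractal_operator (fun=> B) = B) A.

(* For finite I the fractal operator is regarded as acting on compact sets. *)
Definition is_attractor (A : set X) : Prop :=
  (finite_set [set: I] -> unique_fixed_set KX A) /\
  (infinite_set [set: I] -> unique_fixed_set BX A).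

(* f_alpha for alpha in {}_(k+1)Omega *)
Fixpoint code_fun k : fin_code m I k.+1 -> tower m X k.+1 -> X :=
  match k with
  | 0 => fun a x => F (a ord0) x
  | k'.+1 => fun a x =>
      F (a ord0) (fun j => code_fun (shift_fin_code a j) (x j))
  end.

(* f_(alpha^1 ... alpha^(k+1)) (A, ..., A) *)
Definition code_image (A : set X) k (a : fin_code m I k.+1) : set X :=
  code_fun a @` tower_set A k.+1.

(* The intersection over k : nat is over the prefixes of length k.+1 >= 1. *)
Definition is_canonical_projection (c : R) (c01 : 0 < c < 1) (A : set X)
    (p : code_space m I c01 -> X) : Prop :=
  forall a, [set p a] = \bigcap_k closure (code_image A (code_prefix a k.+1)).

End attractor.

Section bounded_continuous.
Context {R : realType} (T X : metricType R).

Record bcfun := BCFun {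
  bcfun_fun :> T -> X;
  bcfun_continuous : continuous bcfun_fun;
  bcfun_bounded : metric_bounded (range bcfun_fun) }.

HB.instance Definition _ := gen_eqMixin bcfun.
HB.instance Definition _ := gen_choiceMixin bcfun.

Lemma bcfun_ext (f g : bcfun) : f =1 g -> f = g.
Proof.
case: f g => [f fc fb] [g gc gb] /= /funext fg; subst g.
by rewrite (Prop_irrelevance fc gc) (Prop_irrelevance fb gb).
Qed.

Definition dunif (f g : bcfun) : R := sup (range (fun a => mdist (f a) (g a))).

Lemma dunif_has_ubound (f g : bcfun) :
  has_ubound (range (fun a => mdist (f a) (g a))).
Proof.
have [M fM] := bcfun_bounded f; have [N gN] := bcfun_bounded g.
have [[a0 _]|T0] := pselect ([set: T] !=set0); last first.
  by exists 0 => _ [a _ <-]; exfalso; apply: T0; exists a.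
exists (M + (mdist (f a0) (g a0) + N)) => _ [a _ <-].
rewrite (le_trans (metric_triangle _ (f a0) _))// lerD//.
  by apply: fM; [exists a|exists a0].
rewrite (le_trans (metric_triangle _ (g a0) _))// lerD2l.
by apply: gN; [exists a0|exists a].
Qed.

Lemma dunif_ge (f g : bcfun) a : mdist (f a) (g a) <= dunif f g.
Proof. by apply: ub_le_sup; [exact: dunif_has_ubound|exists a]. Qed.

Lemma dunif_le (f g : bcfun) e : 0 <= e ->
  (forall a, mdist (f a) (g a) <= e) -> dunif f g <= e.
Proof.
move=> e0 h; rewrite /dunif.
have [S0|/set0P/negP/negPn/eqP ->] :=
  pselect (range (fun a => mdist (f a) (g a)) !=set0); last by rewrite sup0.
by apply: ge_sup => // _ [a _ <-].
Qed.

Lemma dunif_ge0 (f g : bcfun) : 0 <= dunif f g.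
Proof.
have [[a _]|T0] := pselect ([set: T] !=set0).
  by rewrite (le_trans _ (dunif_ge f g a)) ?mdist_ge0.
have S0 : range (fun a => mdist (f a) (g a)) = set0.
  by rewrite -subset0 => _ [a _ <-]; apply: T0; exists a.
by rewrite /dunif S0 sup0.
Qed.

Lemma dunifxx f : dunif f f = 0.
Proof.
apply/eqP; rewrite eq_le dunif_ge0 andbT; apply: dunif_le => // a.
by rewrite mdistxx.
Qed.

Lemma dunif_positivity f g : dunif f g = 0 -> f = g.
Proof.
move=> fg0; apply: bcfun_ext => a; apply: (@mdist_positivity R X).
by apply/eqP; rewrite eq_le mdist_ge0 andbT -fg0 dunif_ge.
Qed.

Lemma dunif_sym f g : dunif f g = dunif g f.
Proof.
rewrite /dunif.
have -> // : (fun a => mdist (f a) (g a)) = (fun a => mdist (g a) (f a)).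
by apply/funext => a; rewrite metric_sym.
Qed.

Lemma dunif_triangle g f h : dunif f h <= dunif f g + dunif g h.
Proof.
apply: dunif_le => [|a]; first by rewrite addr_ge0 ?dunif_ge0.
by rewrite (le_trans (metric_triangle _ (g a) _))// lerD ?dunif_ge.
Qed.

HB.instance Definition _ := @isMetric.Build R bcfun dunif
  dunifxx dunif_positivity dunif_sym dunif_triangle.

End bounded_continuous.

Section code_operator.
Context {R : realType} {m : nat} {X : metricType R} {I : Type}.
Context {c : R} {c01 : 0 < c < 1}.
Variable F : gifs m X I.

Local Notation Omega := (code_space m I c01).
Local Notation C := (bcfun Omega X).

Import metricType_numDomainType.

Definition HF_fun (g : power m C) (a : Omega) : X :=
  F (a 0%N) (fun j => g j (shift_code a j)).

Lemma shift_code_dist (a b : Omega) j :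
  mdist (shift_code a j) (shift_code b j) <= mdist a b / c.
Proof.
case/andP: (c01) => c0 _.
apply: limr_le; first exact: code_dist_cvg.
apply: nearW => n; rewrite ler_pdivlMr// mulrC /series/= mulr_sumr.
apply: (@le_trans _ _ (series (code_dist_term a b) n.+1)); last first.
  apply: nondecreasing_cvgn_le; last exact: code_dist_cvg.
  apply/nondecreasing_seqP => k.
  by rewrite /series/= big_nat_recr//= lerDl code_dist_term_ge0.
rewrite /series/= big_nat_recl//= -[leLHS]add0r lerD ?code_dist_term_ge0//.
apply: ler_sum => k _; rewrite /code_dist_term mulrA -exprS.
rewrite ler_wpM2l ?exprn_ge0 ?(ltW c0)// ler_nat.
rewrite /shift_code; case: (asboolP (a k.+1 = b k.+1)) => [->|_]; last exact: leq_b1.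
by rewrite asboolT.
Qed.

Lemma code_dist_head (a b : Omega) : mdist a b < c -> a 0%N = b 0%N.
Proof.
move=> abc; apply: contrapT => ab0; have := code_dist_term_le a b 0%N.
by rewrite /code_dist_term asboolF// mulr1 expr1 leNgt abc.
Qed.

Lemma HF_continuous g : continuous (HF_fun g).
Proof.
case/andP: (c01) => c0 _ a.
apply/(@cvgrPdist_lt _ _ _ _ (nbhs_filter a)) => e e0.
pose y : power m X := fun j => g j (shift_code a j).
have /cvgrPdist_lt/(_ e e0) := @gifs_continuous _ _ _ _ F (a 0%N) y.
rewrite -filter_from_mdist_nbhs => -[r /= r0 yr].
have gj j : \forall b \near a, mdist (y j) (g j (shift_code b j)) < r / 2.
  have /cvgrPdist_lt/(_ (r / 2)) :=
    @bcfun_continuous _ _ _ (g j) (shift_code a j).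
  rewrite divr_gt0// => /(_ isT).
  rewrite -filter_from_mdist_nbhs => -[d /= d0 dr].
  apply/nbhs_mdistP; exists (d * c) => /=; first by rewrite mulr_gt0.
  move=> b abd; apply: dr => /=.
  by rewrite (le_lt_trans (shift_code_dist _ _ _))// ltr_pdivrMr.
have gJ : \forall b \near a,
    forall j, mdist (y j) (g j (shift_code b j)) < r / 2.
  apply: (@filter_forall _ 'I_m (fun j b => mdist (y j) (g j (shift_code b j)) < r / 2) (nbhs a) (nbhs_filter a)).
  exact: gj.
have a0 : nbhs a [set b : Omega | a 0%N = b 0%N].
  rewrite -(@filter_from_mdist_nbhs R Omega a).
  by exists c => //= b; exact: code_dist_head.
apply: (@filterS2 _ _ (nbhs_filter a) _ _ _ _ a0 gJ) => b ab gb.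
rewrite /HF_fun -ab; apply: (yr (fun j => g j (shift_code b j))) => /=.
have : r / 2 < r by rewrite ltr_pdivrMr// ltr_pMr// ltr1n.
apply: le_lt_trans; apply: dmax_le; first by rewrite ltW ?divr_gt0.
by move=> j; apply/ltW/gb.
Qed.

Lemma HF_bounded g : metric_bounded (range (HF_fun g)).
Proof.
pose B := [set x : power m X | forall j, range (g j) (x j)].
have [|M BM] := @gifs_bounded _ _ _ _ F B.
  have /choice[N gN] j := bcfun_bounded (g j).
  exists (\big[Num.max/0]_j N j) => x y Bx By; apply: dmax_le => [|j].
    exact: bigmax_ge_id.
  apply: (le_trans (gN j _ _ (Bx j) (By j))).
  exact: (le_bigmax_cond _ (fun j => N j)).
have HFB a : (\bigcup_i (F i @` B)) (HF_fun g a).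
  by exists (a 0%N) => //; exists (fun j => g j (shift_code a j)).
by exists M => _ _ [a _ <-] [b _ <-]; apply: BM; exact: HFB.
Qed.

Definition HF (g : power m C) : C := BCFun (@HF_continuous g) (HF_bounded g).

Definition is_pi0 (p : C) : Prop :=
  unique (fun q : C => HF (fun=> q) = q /\
    forall f : C, iter_power HF n (tower_diag m f n) @[n --> \oo] --> q) p.

End code_operator.

Section contractions.
Context {R : realType} {m : nat} {X : metricType R} {I : Type}.

Definition comparison_function (phi : R -> R) : Prop :=
  [/\ forall t, 0 <= t -> 0 <= phi t,
      forall s t, 0 <= s -> s <= t -> phi s <= phi t,
      forall t, 0 <= t -> phi s @[s --> t^'+] --> phi t &
      forall t, 0 < t -> phi t < t].

Definition phi_contraction (phi : R -> R) (f : power m X -> X) : Prop :=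
  forall x y, mdist (f x) (f y) <= phi (mdist x y).

Definition meir_keeler (f : power m X -> X) : Prop :=
  forall e : R, 0 < e -> exists2 delta : R, 0 < delta &
    forall x y, mdist x y < e + delta -> mdist (f x) (f y) < e.

Definition uniformly_meir_keeler (f : I -> power m X -> X) : Prop :=
  forall e : R, 0 < e -> exists delta lambda : R,
    [/\ 0 < delta, 0 < lambda &
     forall i x y, mdist x y < e + delta -> mdist (f i x) (f i y) < e - lambda].

End contractions.

(* Main.v *)
Require Import Defs.
From mathcomp Require Import all_boot all_order all_algebra.
From mathcomp Require Import all_classical all_reals all_analysis.
From mathcomp Require Import lra.

Import Order.TTheory GRing.Theory Num.Theory.
Import numFieldNormedType.Exports.
Local Open Scope classical_set_scope.
Local Open Scope ring_scope.

(** The fixed point [pi0] unfolds itself: applying [pi0 = HF pi0] k times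
writes [pi0 a] as the image under the k-th prefix map [f_(a^1 ... a^k)] of a
point all of whose coordinates are values of [pi0].  As soon as [pi0] takes its
values in the attractor [A], each [pi0 a] therefore lies in all the sets of the
intersection ([fixed_point_code_image]).  The values are in [A] because [pi0]
is the limit of the iterates of [HF] started at a constant function with value
in [A]: these iterates remain [A]-valued, since every [f_i] maps [A^m] into
[A], and [A] is closed ([lim_iter_HF_in]).

The intersection contains no other point, because the diameters of the sets
[f_(a^1 ... a^k)(A, ..., A)] tend to 0, uniformly in the code
([code_fun_small]).  Only one contractive property is used for this: for every
[e > 0] there is [t > 0] such that arguments in [A^m] at distance less than
[e + t] have images under every [f_i] at distance less than [e - t].  If the
infimum [L] of the bounds valid at some level were positive, a bound smaller
than [L + t] at one level would give the bound [L - t] at the next one.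

That property follows from each of the three hypotheses.  For comparison
functions it comes from [phi e < e] and right continuity at [e]; for uniformly
Meir-Keeler families [t] is the smaller of the two given margins.  For finitely
many Meir-Keeler maps the definition lacks the margin [t] in the conclusion; here the attractor is
compact, and compactness of [A^m] supplies the margin
([finite_meir_keeler_compact]). *)

(** * Metric spaces, compactness and powers *)

Section compactness.
Context {R : realType} {m : nat} {X : metricType R}.
Import metricType_numDomainType.

Lemma near_mdist_lt {Y : metricType R} (x : Y) (e : R) : 0 < e ->
  \forall y \near x, mdist x y < e.
Proof. by move=> e0; apply/nbhs_mdistP; exists e. Qed.

Lemma closure_mdist_le {S : set X} {e : R} :
  (forall x y, S x -> S y -> mdist x y < e) ->
  forall x y, closure S x -> closure S y -> mdist x y <= e.
Proof.
move=> Se x y Sx Sy; apply/ler_addgt0Pl => d d0.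
have d2 : 0 < d / 2 by rewrite divr_gt0.
have [x' [Sx' /= xx']] := Sx _ (near_mdist_lt x _ d2).
have [y' [Sy' /= yy']] := Sy _ (near_mdist_lt y _ d2).
have := metric_triangle x x' y; have := metric_triangle x' y' y.
have := Se _ _ Sx' Sy'; rewrite (metric_sym y') => *; lra.
Qed.

Lemma compact_metric_bounded {A : set X} : compact A -> metric_bounded A.
Proof.
move=> cA; have [->|/set0P[a Aa]] := eqVneq A set0.
  by exists 0 => x y [].
have /compact_near_coveringP cov := cA.
have /filter_ex[M AM] : \forall M \near +oo, A `<=` [set x | mdist a x < M].
  apply: cov => x Ax; near=> y M => /=.
  rewrite (le_lt_trans (metric_triangle _ x _))//.
  have xy : mdist x y < 1 by near: y; exact: near_mdist_lt.
  have ? : mdist a x + 1 < M by near: M; apply: nbhs_pinfty_gt; exact: num_real.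
  by lra.
exists (M + M) => x y Ax Ay.
rewrite (le_trans (metric_triangle _ a _))// lerD// ?(metric_sym x) ltW//.
- exact: AM Ax.
- exact: AM Ay.
Unshelve. all: by end_near. Qed.

(** Tychonoff's theorem is about the topology of pointwise convergence, which
agrees with that of the maximum metric because there are finitely many
coordinates; the identity map transports compactness from one to the other. *)
Lemma compact_power {A : set X} : compact A ->
  compact [set x : power m X | forall j, A (x j)].
Proof.
move=> cA.
pose K : set {ptws 'I_m -> X} := [set f | forall j, A (f j)].
have cK : compact K by exact: (@tychonoff 'I_m (fun=> X) (fun=> A) (fun=> cA)).
pose g (f : {ptws 'I_m -> X}) : power m X := f.
have -> : [set x : power m X | forall j, A (x j)] = g @` K.
  by apply/seteqP; split => [x Ax|_ [x Ax <-]]//; exists x.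
apply: continuous_compact => //; apply: continuous_subspaceT => f.
have FF : Filter (nbhs f) by exact: nbhs_filter.
apply/(@cvgrPdist_le R (power m X) _ (nbhs f) FF) => e e0.
have : \forall h \near f, forall j, mdist (f j) (h j) < e.
  apply: (@filter_forall {ptws 'I_m -> X} 'I_m
    (fun j h => mdist (f j) (h j) < e) (nbhs f) FF) => j.
  have := @proj_continuous 'I_m (fun=> X) j f.
  by move/(@cvgrPdist_lt R X _ (nbhs f) FF) => /(_ e e0).
apply: filterS => h fh; apply: dmax_le => [|j]; exact: ltW.
Qed.

End compactness.

Lemma near_finite_forall {I T : Type} (G : set_system T) (P : I -> T -> Prop) :
  Filter G -> finite_set [set: I] ->
  (forall i, \forall t \near G, P i t) -> \forall t \near G, forall i, P i t.
Proof.
move=> FG fI GP.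
have /(@finite_seqP {classic I})[s Is] := fI.
have : \forall t \near G, forall i : {classic I}, i \in s -> P i t.
  elim: s {Is} => [|i s IHs]; first by apply: nearW.
  apply: filterS2 (GP i) IHs => t Pi Ps k.
  by rewrite inE => /orP[/eqP->|/Ps].
apply: filterS => t Pt i; apply: Pt.
by have : [set: I] i by []; rewrite Is.
Qed.

Lemma near_fst {U V : topologicalType} {u : U} {v : V} (P : set U) :
  (\forall x \near u, P x) -> \forall p \near (u, v), P p.1.
Proof. exact: (@cvg_fst _ _ (nbhs u) (nbhs v) _ P). Qed.

Lemma near_snd {U V : topologicalType} {u : U} {v : V} (P : set V) :
  (\forall y \near v, P y) -> \forall p \near (u, v), P p.2.
Proof. exact: (@cvg_snd _ _ (nbhs u) (nbhs v) _ P). Qed.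

(** * Contractive conditions *)

Section contractive_conditions.
Context {R : realType} {m : nat} {X : metricType R} {I : Type}.
Import metricType_numDomainType.

(** The two margins of a uniformly Meir-Keeler family are merged into a single
[t]; the restriction to [B] makes room for margins that come from compactness.
*)
Definition uniformly_meir_keeler_on (B : set X) (f : I -> power m X -> X) :=
  forall e : R, 0 < e -> exists2 t : R, 0 < t &
    forall i (x y : power m X), (forall j, B (x j)) -> (forall j, B (y j)) ->
      mdist x y < e + t -> mdist (f i x) (f i y) < e - t.

(** By right continuity [phi] remains below the midpoint [(phi e + e) / 2] up
to some [s > e], and by monotonicity below [s] everywhere. *)
Lemma comparison_uniformly_meir_keeler {phi : R -> R}
    {f : I -> power m X -> X} : comparison_function phi ->
  (forall i, phi_contraction phi (f i)) -> uniformly_meir_keeler f.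
Proof.
move=> [_ phi_nd phi_rc phi_lt] fphi e e0.
have phie := phi_lt _ e0.
have : \forall s \near e^'+, e < s /\ phi s < (phi e + e) / 2.
  near=> s; split; first by near: s; exact: nbhs_right_gt.
  near: s; apply: (cvgr_lt (phi e)); first exact/phi_rc/ltW.
  by lra.
case/filter_ex => s [es phis].
exists (s - e), ((e - phi e) / 2); split; [lra|lra|move=> i x y].
rewrite addrC subrK => xys; rewrite (le_lt_trans (fphi i x y))//.
rewrite (le_lt_trans (phi_nd _ s _ _)) ?mdist_ge0 ?ltW//.
by rewrite (lt_le_trans phis)//; lra.
Unshelve. all: by end_near. Qed.

Lemma uniformly_meir_keelerW {f : I -> power m X -> X} (B : set X) :
  uniformly_meir_keeler f -> uniformly_meir_keeler_on B f.
Proof.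
move=> fmk e /fmk[d [l [d0 l0 fdl]]].
exists (Num.min d l) => [|i x y _ _ xy]; first by rewrite lt_min d0.
have : e - l <= e - Num.min d l by rewrite lerD2l lerN2 ge_min lexx orbT.
apply: lt_le_trans; apply: fdl; rewrite (lt_le_trans xy)//.
by rewrite lerD2l ge_min lexx.
Qed.

(** Pairs in a small neighbourhood of a given pair [(x, y)] satisfy the
implication with a margin: if [x] and [y] are closer than [e + d], the strict
inequality [mdist (f x) (f y) < e] leaves a gap that survives small
perturbations; otherwise the premise fails nearby.  Compactness makes the margin
uniform. *)
Lemma meir_keeler_compact {f : power m X -> X} {K : set (power m X)} {e : R} :
  continuous f -> meir_keeler f -> compact K -> 0 < e ->
  \forall t \near 0^'+, forall x y, K x -> K y ->
    mdist x y < e + t -> mdist (f x) (f y) < e - t.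
Proof.
move=> fc fmk cK e0.
have /compact_near_coveringP cov := compact_setX cK cK.
suff : \forall t \near 0^'+, K `*` K `<=`
    [set p | mdist p.1 p.2 < e + t -> mdist (f p.1) (f p.2) < e - t].
  by apply: filterS => t KK x y Kx Ky; exact: (KK (x, y)).
apply: cov => -[x y] [/= _ _].
have [d d0 fd] := fmk _ e0.
have tri (Y : metricType R) (a b a' b' : Y) :
    mdist a b <= mdist a a' + mdist a' b' + mdist b b'.
  rewrite (le_trans (metric_triangle _ b' _))// (metric_sym b b') lerD2r.
  exact: metric_triangle.
have [xyd|xyd] := ltP (mdist x y) (e + d).
  pose g := e - mdist (f x) (f y).
  have g0 : 0 < g by rewrite subr_gt0 fd.
  near=> p t => /= _.
  have px : mdist (f x) (f p.1) < g / 4.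
    near: p; apply: (near_fst (fun z => mdist (f x) (f z) < g / 4)).
    by have /cvgrPdist_lt := fc x; apply; lra.
  have py : mdist (f y) (f p.2) < g / 4.
    near: p; apply: (near_snd (fun z => mdist (f y) (f z) < g / 4)).
    by have /cvgrPdist_lt := fc y; apply; lra.
  have t4 : t < g / 4 by near: t; apply: nbhs_right_lt; lra.
  have := tri _ (f p.1) (f p.2) (f x) (f y).
  rewrite (metric_sym (f p.1) (f x)) (metric_sym (f p.2) (f y)).
  have gE : mdist (f x) (f y) = e - g by rewrite /g subKr.
  by lra.
near=> p t => /= pt; exfalso.
have px : mdist x p.1 < d / 4.
  near: p; apply: (near_fst (fun z => mdist x z < d / 4)).
  by apply: near_mdist_lt; lra.
have py : mdist y p.2 < d / 4.
  near: p; apply: (near_snd (fun z => mdist y z < d / 4)).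
  by apply: near_mdist_lt; lra.
have t4 : t < d / 4 by near: t; apply: nbhs_right_lt; lra.
have := tri _ x y p.1 p.2.
by lra.
Unshelve. all: by end_near. Qed.

Lemma finite_meir_keeler_compact {f : I -> power m X -> X} {A : set X} :
  finite_set [set: I] -> (forall i, continuous (f i)) ->
  (forall i, meir_keeler (f i)) -> compact A -> uniformly_meir_keeler_on A f.
Proof.
move=> fI fc fmk cA e e0.
have : \forall t \near 0^'+, 0 < t /\ forall i (x y : power m X),
    (forall j, A (x j)) -> (forall j, A (y j)) ->
    mdist x y < e + t -> mdist (f i x) (f i y) < e - t.
  near=> t; split; first by near: t; exact: nbhs_right_gt.
  near: t; apply: near_finite_forall => // i.
  exact: meir_keeler_compact (fc i) (fmk i) (compact_power cA) e0.
by case/filter_ex => t [t0 ft]; exists t.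
Unshelve. all: by end_near. Qed.

End contractive_conditions.

(** * Diameters of the code images *)

Section code_images.
Context {R : realType} {m : nat} {X : metricType R} {I : Type}.
Context {F : gifs m X I} {A : set X}.
Hypothesis FA : forall i x, (forall j, A (x j)) -> A (F i x).

Lemma code_fun_in k (a : fin_code m I k.+1) x :
  tower_set A k.+1 x -> A (code_fun F a x).
Proof.
elim: k a x => [|k IHk] a x Ax /=; first exact: FA.
by apply: FA => j; apply: IHk; exact: Ax.
Qed.

(** A positive infimum of the bounds valid at some level would be improved at
the next level by the contractive property taken at that infimum.  The bound at
the first level is that of [A], which contains all the code images. *)
Lemma code_fun_small : metric_bounded A -> uniformly_meir_keeler_on A F ->
  forall e, 0 < e -> exists k, forall (a : fin_code m I k.+1) x y,
    tower_set A k.+1 x -> tower_set A k.+1 y ->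
    mdist (code_fun F a x) (code_fun F a y) < e.
Proof.
move=> [M AM] Fmk e e0.
pose D := [set r : R | 0 <= r /\ exists k, forall (a : fin_code m I k.+1) x y,
  tower_set A k.+1 x -> tower_set A k.+1 y ->
  mdist (code_fun F a x) (code_fun F a y) <= r].
have D0 : D !=set0.
  exists (Num.max 0 M); split; first by rewrite le_max lexx.
  exists 0%N => a x y Ax Ay; rewrite le_max AM ?orbT//; exact: code_fun_in.
have lD : has_lbound D by exists 0 => r [].
suff : inf D < e.
  move=> /(inf_lt D0)[r [_ [k Dk]] re]; exists k => a x y Ax Ay.
  exact: le_lt_trans (Dk a x y Ax Ay) re.
have [|L0] := leP (inf D) 0; first by move/le_lt_trans; apply.
have [t t0 Ft] := Fmk _ L0.
have [r [r0 [k Dk]] rL] := inf_adherent t0 (conj D0 lD).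
(* The maximum with 0 keeps the new bound in [D] without comparing [t] to
   [inf D]. *)
suff : inf D <= Num.max 0 (inf D - t).
  by rewrite le_max => /orP[]; lra.
apply: ge_inf => //; split; first by rewrite le_max lexx.
exists k.+1 => a x y Ax Ay; rewrite le_max; apply/orP; right; apply: ltW.
apply: Ft => [j|j|]; [exact/code_fun_in/Ax|exact/code_fun_in/Ay|].
apply: le_lt_trans rL; apply: dmax_le => // j.
by apply: Dk; [exact: Ax|exact: Ay].
Qed.

End code_images.

(** * The fixed point of the code operator *)

Section fixed_point.
Context {R : realType} {m : nat} {X : metricType R} {I : Type}.
Context {c : R} {c01 : 0 < c < 1}.
Context {F : gifs m X I} {A : set X}.
Local Notation Omega := (code_space m I c01).
Import metricType_numDomainType.

Lemma fixed_point_code_image {p : bcfun Omega X} : HF F (fun=> p) = p ->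
  (forall a, A (p a)) ->
  forall k (a : Omega), code_image F A (code_prefix a k.+1) (p a).
Proof.
move=> HFp Ap.
have pE (a : Omega) : p a = F (a 0%N) (fun j => p (shift_code a j)).
  by rewrite -{1}HFp.
elim=> [|k IHk] a.
  by exists (fun j => p (shift_code a j)) => [j|]; [exact: Ap|rewrite [RHS]pE].
have xs (j : 'I_m) : exists x : tower m X k.+1, tower_set A k.+1 x /\
    code_fun F (code_prefix (shift_code a j) k.+1) x = p (shift_code a j).
  by have [x Ax xE] := IHk (shift_code a j); exists x.
have [x xP] := choice xs.
exists x => [j|]; first by have [] := xP j.
rewrite [RHS]pE /=; congr (gifs_fun F _ _); apply/funext => j.
by have [_ <-] := xP j.
Qed.

(** A constant function with value in [A] is a starting point whose iterates
are all [A]-valued; convergence in [dunif] is stronger than pointwise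
convergence. *)
Lemma lim_iter_HF_in {p : bcfun Omega X} :
  (forall i x, (forall j, A (x j)) -> A (F i x)) ->
  A !=set0 -> closed A ->
  (forall f : bcfun Omega X,
    iter_power (HF F) n (tower_diag m f n) @[n --> \oo] --> p) ->
  forall a, A (p a).
Proof.
move=> FA [a0 Aa0] clA pP a.
have bc : metric_bounded (range (fun _ : Omega => a0)).
  by exists 0 => _ _ [? _ <-] [? _ <-]; rewrite mdistxx.
have cc : continuous (fun _ : Omega => a0).
  by move=> b; exact: (@cvg_cst _ a0 _ _ (nbhs_filter b)).
pose f : bcfun Omega X := BCFun cc bc.
have An n b : A (iter_power (HF F) n (tower_diag m f n) b).
  by elim: n b => [|n IHn] b //=; apply: FA => j; exact: IHn.
apply: (@closed_cvg _ _ \oo _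
  (fun n => iter_power (HF F) n (tower_diag m f n) a) A clA) => //.
  exact: nearW.
apply/(@cvgrPdist_lt R X) => e e0.
have /(@cvgrPdist_lt R (bcfun Omega X)) /(_ e e0) := pP f.
by apply: filterS => n; apply: le_lt_trans; exact: dunif_ge.
Qed.

End fixed_point.

Theorem proposition4p3 (R : realType) (m : nat) (hm : (0 < m)%N)
    (X : completeMetricType R) (I : Type) (I0 : [set: I] !=set0)
    (c : R) (c01 : 0 < c < 1) (F : gifs m X I)
    (hF : (exists phi : R -> R, comparison_function phi /\
             forall i, phi_contraction phi (F i)) \/
          uniformly_meir_keeler F \/
          (finite_set [set: I] /\ forall i, meir_keeler (F i)))
    (A : set X) (hA : is_attractor F A)
    (pi0 : bcfun (code_space m I c01) X) (hpi0 : is_pi0 F pi0) :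
  is_canonical_projection F A pi0.
Proof.
have [Afin Ainf] := hA; have [[HFpi0 pi0_lim] _] := hpi0.
have [[A0 clA bA] fixA] : BX A /\ fractal_operator F (fun=> A) = A.
  have [fI|infI] := pselect (finite_set [set: I]); last by have [] := Ainf infI.
  have [[[A0 cA] fixA] _] := Afin fI; split=> //; split=> //.
    exact: compact_closed (@metric_hausdorff _ _) cA.
  exact: compact_metric_bounded.
have FA i (x : power m X) : (forall j, A (x j)) -> A (F i x).
  by move=> Ax; rewrite -fixA; apply: subset_closure; exists i => //; exists x.
have Fmk : uniformly_meir_keeler_on A F.
  case: hF => [[phi [hphi Fphi]]|[Fmk|[fI Fmk]]].
  - exact/uniformly_meir_keelerW/(comparison_uniformly_meir_keeler hphi Fphi).
  - exact: uniformly_meir_keelerW.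
  - have [[[_ cA] _] _] := Afin fI.
    exact: finite_meir_keeler_compact fI (@gifs_continuous _ _ _ _ F) Fmk cA.
have Api0 := lim_iter_HF_in FA A0 clA pi0_lim.
have pi0_in k a := subset_closure (fixed_point_code_image HFpi0 Api0 k a).
move=> a; apply/seteqP; split=> [_ -> k _|q qa]; first exact: pi0_in.
apply: (@mdist_positivity R X); apply/eqP; rewrite eq_le mdist_ge0 andbT.
apply/ler_addgt0Pl => e e0; rewrite addr0.
have [k Fk] := code_fun_small FA bA Fmk e e0.
apply: (closure_mdist_le _ _ _ (qa k Logic.I) (pi0_in k a)).
by move=> _ _ [x Ax <-] [y Ay <-]; exact: Fk.
Qed.
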